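(* Let $m$ be a positive integer, let $x_1,\dots,x_m\in V$ be pairwise distinct, let $\varphi_1,\dots,\varphi_m\in E$ and assume $H[x_1:\varphi_1,\dots,x_m:\varphi_m]$. Let $k=k[x_1:\varphi_1,\dots,x_m:\varphi_m]$ and $\varphi\in S(k)$. Then $\#(\gamma[x_1:\varphi_1,\dots,x_m:\varphi_m,\varphi])$ is equivalent to $P_\forall(\{\#(k,\varphi,\sigma'):\sigma'\in\Xi(k)\})$, i.e. $\#(\gamma[x_1:\varphi_1,\dots,x_m:\varphi_m,\varphi])$ is true if and only if $\#(k,\varphi,\sigma')$ is true for every $\sigma'\in\Xi(k)$.
   Context: Language $(V,F,C,\#)$: variables $V$; constants $C$ with meanings $\#(c)$; operator symbols $F$, each $f$ with applicability condition $A_f(x_1,\dots,x_n)$ and value $P_f(x_1,\dots,x_n)$ when applicable; auxiliary symbols $($, $)$, $,$, $:$, $\{\}$; all disjoint and uniquely readable; expressions are strings. $F$ contains $\forall$ with $A_\forall(x_1)$ iff $x_1$ is a set all of whose elements are true or false (and false on sequences of length $\ne1$), and $P_\forall(x_1)=$ ''every element of $x_1$ is true''. Soops: finite sequences of ordered pairs; $\varepsilon$ empty, $\|$ concatenation, pairs identified with one-term soops; $\mathrm{dom}$ = set of first components; $\alpha(a)=b$ for univocal soops; $\alpha\sqsubseteq\gamma$: $\alpha$ is an initial segment of $\gamma$. Simultaneous induction on $n\ge1$: $K(1)=\{\varepsilon\}$, $\Xi(\varepsilon)=\{\varepsilon\}$, $E(1,\varepsilon)=C$, $\#(\varepsilon,c,\varepsilon)=\#(c)$,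 $V_b(c)=V_f(c)=\emptyset$. $K(n)^+$: all $h\|(y,\varphi)$, $h\in K(n)$, $\varphi\in E(n,h)$, $y\in V\setminus\mathrm{dom}(h)$, $\#(h,\varphi,\rho)$ a set for all $\rho\in\Xi(h)$; $K(n+1)=K(n)\cup K(n)^+$; $\Xi(h\|(y,\varphi))=\{\rho\|(y,s):\rho\in\Xi(h),s\in\#(h,\varphi,\rho)\}$. $E(n+1,k)$ is the union of: (0) $E(n,k)$ if $k\in K(n)$; (a) for $k=h\|(y,\varphi)\in K(n)^+$, $t\in E(n,h)$ with $y\notin V_b(t)$, $\#(k,t,\rho\|(y,s))=\#(h,t,\rho)$; (b) for such $k$, $y$ itself, $\#(k,y,\sigma)=\sigma(y)$, $V_f(y)=\{y\}$, $V_b(y)=\emptyset$; (c) for $k\in K(n)$, $(\varphi)(\varphi_1,\dots,\varphi_m)$ with $\varphi,\varphi_i\in E(n,k)$, $\#(k,\varphi,\sigma)$ an $m$-ary function defined at $(\#(k,\varphi_i,\sigma))_i$ for all $\sigma$, meaning its value, $V_b,V_f$ unions; (d) for $k\in K(n)$, $(f)(\varphi_1,\dots,\varphi_m)$, $f\in F$, $\varphi_i\in E(n,k)$, $A_f(\#(k,\varphi_1,\sigma),\dots)$ for all $\sigma$, meaning $P_f(\dots)$, $V_b,V_f$ unions; (e) for $k\in K(n)$, $\{\}(x_1:\varphi_1,\dots,x_m:\varphi_m,\varphi)$, $x_i$ distinct in $V\setminus\mathrm{dom}(k)$, $k'_i=k\|(x_1,\varphi_1)\|\dots\|(x_i,\varphi_i)\in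 K(n)$, $\varphi_i\in E(n,k'_{i-1})$ with set meanings, $\varphi\in E(n,k'_m)$; meaning $\{\#(k'_m,\varphi,\sigma'):\sigma'\in\Xi(k'_m),\sigma\sqsubseteq\sigma'\}$; $V_b=\{x_1,\dots,x_m\}\cup\bigcup V_b(\varphi_i)\cup V_b(\varphi)$; $V_f=V_f(\varphi_1)\cup(V_f(\varphi_2)\setminus\{x_1\})\cup\dots\cup(V_f(\varphi)\setminus\{x_1,\dots,x_m\})$. $K=\bigcup K(n)$, $E(k)=\bigcup_nE(n,k)$, $E=\bigcup_kE(k)$; $S(k)$: $t\in E(k)$ with $\#(k,t,\sigma)$ true or false for all $\sigma\in\Xi(k)$; $\#(t)=\#(\varepsilon,t,\varepsilon)$. $H[x_1:\varphi_1,\dots,x_m:\varphi_m]$ means: with $k_0=\varepsilon$, $k_i=(x_1,\varphi_1)\|\dots\|(x_i,\varphi_i)$, for each $i=1..m$: $k_{i-1}\in K$, $\varphi_i\in E(k_{i-1})$ and $\#(k_{i-1},\varphi_i,\rho)$ is a set for all $\rho\in\Xi(k_{i-1})$ (then $k_i\in K$). Then $k[x_1:\varphi_1,\dots,x_m:\varphi_m]=k_m$. For $\varphi\in S(k_m)$: $\gamma[x_m:\varphi_m,\varphi]=(\forall)(\{\}(x_m:\varphi_m,\varphi))$ and $\gamma[x_{i-1}:\varphi_{i-1},\dots,x_m:\varphi_m,\varphi]=(\forall)(\{\}(x_{i-1}:\varphi_{i-1},\gamma[x_i:\varphi_i,\dots,x_m:\varphi_m,\varphi]))$ for $i=m,\dots,2$.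 *)

(* Defs.v *)
From Stdlib Require Import List Classical ClassicalEpsilon.
Import ListNotations.

Set Implicit Arguments.
Unset Strict Implicit.
Unset Printing Implicit Defensive.

(** * The ambient set theory

    Meanings live in a universe of objects, some of which are sets; there may
    be objects that are not sets.  The truth values "true" and "false" are two
    distinct objects.  Replacement is stated for arbitrary partial functional
    relations, so it also yields separation and the empty set. *)

Record universe := Universe {
  obj :> Type;
  is_set : obj -> Prop;
  mem : obj -> obj -> Prop;
  vtrue : obj;
  vfalse : obj;
  vtrue_neq_vfalse : vtrue <> vfalse;
  mem_is_set : forall x A, mem x A -> is_set A;
  set_ext : forall A B, is_set A -> is_set B ->
    (forall x, mem x A <-> mem x B) -> A = B;
  set_pairing : forall a b,
    exists A, is_set A /\ forall x, mem x A <-> x = a \/ x = b;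
  set_union : forall A, is_set A ->
    exists B, is_set B /\ forall x, mem x B <-> exists2 y, mem y A & mem x y;
  set_replacement : forall (A : obj) (R : obj -> obj -> Prop), is_set A ->
    (forall x y z, mem x A -> R x y -> R x z -> y = z) ->
    exists B, is_set B /\ forall y, mem y B <-> exists2 x, mem x A & R x y
}.

Arguments is_set {u} _.
Arguments mem {u} _ _.
Arguments vtrue {u}.
Arguments vfalse {u}.

Section Objects.
Variable U : universe.
Implicit Types (x g v : U) (xs : list U).

(* "the object u such that P u"; arbitrary if there is none. *)
Definition the (P : U -> Prop) : U := epsilon (inhabits vtrue) P.

Definition truth_valued x : Prop := x = vtrue \/ x = vfalse.

Definition truth (Q : Prop) : U :=
  if excluded_middle_informative Q then vtrue else vfalse.

(* The set { x | P x }; meaningful only when the class P is a set. *)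
Definition setof (P : U -> Prop) : U :=
  the (fun A => is_set A /\ forall x, mem x A <-> P x).

Definition upair x y : U := setof (fun z => z = x \/ z = y).
Definition kpair x y : U := upair (upair x x) (upair x y).

(* (x1) = x1 and (x1, ..., x(n+1)) = ((x1, ..., xn), x(n+1)). *)
Definition tuple xs : U :=
  match xs with
  | [] => setof (fun _ => False)
  | x :: r => fold_left kpair r x
  end.

Definition is_function (m : nat) g : Prop :=
  is_set g
  /\ (forall p, mem p g -> exists xs v, length xs = m /\ p = kpair (tuple xs) v)
  /\ (forall a v w, mem (kpair a v) g -> mem (kpair a w) g -> v = w).

Definition defined_at g xs : Prop := exists v, mem (kpair (tuple xs) v) g.
Definition apply g xs : U := the (fun v => mem (kpair (tuple xs) v) g).

End Objects.

(** * Languages and strings *)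

Record language (U : universe) := Language {
  var : Type;
  cst : Type;
  op : Type;
  cst_meaning : cst -> U;
  (* [op_app f xs] and [op_val f xs] are A_f(xs) and P_f(xs); the latter is
     meaningful only when the former holds. *)
  op_app : op -> list U -> Prop;
  op_val : op -> list U -> U;
  op_forall : op;
  op_forall_app : forall xs, op_app op_forall xs <->
    exists x, xs = [x] /\ is_set x /\ forall y, mem y x -> truth_valued y;
  op_forall_val : forall x, op_app op_forall [x] ->
    op_val op_forall [x] = truth U (forall y, mem y x -> y = vtrue)
}.

Arguments op_app {U l} _ _.
Arguments op_val {U l} _ _.
Arguments op_forall {U} l.
Arguments cst_meaning {U l} _.

Section Soops.
Variables A B : Type.

Definition soop := list (A * B).
Definition dom (s : soop) : list A := map fst s.
Definition initial_segment (s t : soop) : Prop := exists r, t = s ++ r.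

End Soops.

Section Lang.
Variable U : universe.
Variable L : language U.

Inductive symbol :=
| SVar (y : var L) | SCst (c : cst L) | SOp (f : op L)
| LPar | RPar | Comma | Colon | Braces.

Definition expr := list symbol.
Definition ctx := soop (var L) expr.
Definition state := soop (var L) U.

(* s(y), for univocal s with y in dom s. *)
Definition lookup (s : state) (y : var L) : U := the (fun u => In (y, u) s).

Fixpoint comma_sep (ts : list expr) : expr :=
  match ts with
  | [] => []
  | [t] => t
  | t :: ts => t ++ Comma :: comma_sep ts
  end.

(* (t)(t1,...,tm) *)
Definition app_str (t : expr) (ts : list expr) : expr :=
  LPar :: t ++ RPar :: LPar :: comma_sep ts ++ [RPar].

(* {}(x1:t1,...,xm:tm,t) *)
Definition set_str (bs : ctx) (t : expr) : expr :=
  Braces :: LPar ::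
  comma_sep (map (fun b => SVar (fst b) :: Colon :: snd b) bs ++ [t]) ++ [RPar].

(** * The simultaneous induction *)

Record stage := Stage {
  stK : ctx -> Prop;
  stXi : ctx -> state -> Prop;
  stE : ctx -> expr -> Prop;
  stmean : ctx -> expr -> state -> U;
  stVb : ctx -> expr -> var L -> Prop;
  stVf : ctx -> expr -> var L -> Prop
}.

Definition stage1 : stage := {|
  stK k := k = [];
  stXi k s := k = [] /\ s = [];
  stE k t := k = [] /\ exists c, t = [SCst c];
  stmean _ t _ := the (fun u => exists c, t = [SCst c] /\ u = cst_meaning c);
  stVb _ _ _ := False;
  stVf _ _ _ := False
|}.

(* h || (y,t) belongs to K(n)^+. *)
Definition Kplus (S : stage) (h : ctx) (y : var L) (t : expr) : Prop :=
  stK S h /\ stE S h t /\ ~ In y (dom h)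
  /\ forall r, stXi S h r -> is_set (stmean S h t r).

(* [clause S k t M B F]: one of the rules (0), (a)-(e) applied to the level S
   puts t into the next E(k), with meaning M s for s in Xi(k), bound variables B
   and free variables F.  Different rules, or different uses of the same rule,
   may apply to the same k and t.  In [clause_a] and [clause_b] the states of
   interest have the shape r || (y,s), and [removelast] recovers r.  A
   decomposition bs = l ++ (x,p) :: r in [clause_e] amounts to an index i, with
   k'_(i-1) = k ++ l, x = x_i, p = phi_i and k'_i = k ++ l ++ [(x,p)]. *)
Inductive clause (S : stage) :
  ctx -> expr -> (state -> U) -> (var L -> Prop) -> (var L -> Prop) -> Prop :=
| clause_0 k t : stK S k -> stE S k t ->
    clause S k t (stmean S k t) (stVb S k t) (stVf S k t)
| clause_a h y p t : Kplus S h y p -> stE S h t -> ~ stVb S h t y ->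
    clause S (h ++ [(y, p)]) t (fun s => stmean S h t (removelast s))
      (stVb S h t) (stVf S h t)
| clause_b h y p : Kplus S h y p ->
    clause S (h ++ [(y, p)]) [SVar y] (fun s => lookup s y)
      (fun _ => False) (fun x => x = y)
| clause_c k t ts : stK S k -> ts <> [] ->
    stE S k t -> (forall p, In p ts -> stE S k p) ->
    (forall s, stXi S k s ->
       is_function (length ts) (stmean S k t s)
       /\ defined_at (stmean S k t s) (map (fun p => stmean S k p s) ts)) ->
    clause S k (app_str t ts)
      (fun s => apply (stmean S k t s) (map (fun p => stmean S k p s) ts))
      (fun x => exists2 p, In p (t :: ts) & stVb S k p x)
      (fun x => exists2 p, In p (t :: ts) & stVf S k p x)
| clause_d k f ts : stK S k -> ts <> [] ->
    (forall p, In p ts -> stE S k p) ->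
    (forall s, stXi S k s -> op_app f (map (fun p => stmean S k p s) ts)) ->
    clause S k (app_str [SOp f] ts)
      (fun s => op_val f (map (fun p => stmean S k p s) ts))
      (fun x => exists2 p, In p ts & stVb S k p x)
      (fun x => exists2 p, In p ts & stVf S k p x)
| clause_e k (bs : ctx) t : stK S k -> bs <> [] ->
    NoDup (dom bs) -> (forall x, In x (dom bs) -> ~ In x (dom k)) ->
    (forall l x p r, bs = l ++ (x, p) :: r ->
       stE S (k ++ l) p
       /\ (forall s, stXi S (k ++ l) s -> is_set (stmean S (k ++ l) p s))
       /\ stK S (k ++ l ++ [(x, p)])) ->
    stE S (k ++ bs) t ->
    clause S k (set_str bs t)
      (fun s => setof (fun z => exists s', stXi S (k ++ bs) s'
         /\ initial_segment s s' /\ z = stmean S (k ++ bs) t s'))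
      (fun z => In z (dom bs)
         \/ (exists l x p r, bs = l ++ (x, p) :: r /\ stVb S (k ++ l) p z)
         \/ stVb S (k ++ bs) t z)
      (fun z =>
         (exists l x p r, bs = l ++ (x, p) :: r
            /\ stVf S (k ++ l) p z /\ ~ In z (dom l))
         \/ (stVf S (k ++ bs) t z /\ ~ In z (dom bs))).

Definition next (S : stage) : stage := {|
  stK k := stK S k \/ exists h y p, Kplus S h y p /\ k = h ++ [(y, p)];
  stXi k s := (stK S k /\ stXi S k s)
    \/ exists h y p r v, Kplus S h y p /\ k = h ++ [(y, p)]
         /\ stXi S h r /\ mem v (stmean S h p r) /\ s = r ++ [(y, v)];
  stE k t := exists M B F, clause S k t M B F;
  stmean k t s := the (fun u => exists M B F, clause S k t M B F /\ u = M s);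
  stVb k t x := exists M B F, clause S k t M B F /\ B x;
  stVf k t x := exists M B F, clause S k t M B F /\ F x
|}.

(* [level n] consists of K(n+1), Xi on K(n+1), E(n+1,-), and so on. *)
Fixpoint level (n : nat) : stage :=
  match n with
  | 0 => stage1
  | S n => next (level n)
  end.

Definition inK (k : ctx) : Prop := exists n, stK (level n) k.
Definition Xi (k : ctx) (s : state) : Prop :=
  exists n, stK (level n) k /\ stXi (level n) k s.
Definition inE (k : ctx) (t : expr) : Prop :=
  exists n, stK (level n) k /\ stE (level n) k t.
Definition isExpr (t : expr) : Prop := exists k, inE k t.

(* #(k,t,s), for t in E(k) and s in Xi(k). *)
Definition meaning (k : ctx) (t : expr) (s : state) : U :=
  the (fun u => exists n, stK (level n) k /\ stE (level n) k t
                          /\ u = stmean (level n) k t s).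

Definition meaning0 (t : expr) : U := meaning [] t [].

Definition inS (k : ctx) (t : expr) : Prop :=
  inE k t /\ forall s, Xi k s -> truth_valued (meaning k t s).

(** * The hypothesis H and the closure gamma

    The list bs = [(x1,p1); ...; (xm,pm)] is at the same time the data
    x1:p1,...,xm:pm and the soop k[x1:p1,...,xm:pm]. *)

Definition hypH (bs : ctx) : Prop :=
  forall l x p r, bs = l ++ (x, p) :: r ->
    inK l /\ inE l p /\ forall s, Xi l s -> is_set (meaning l p s).

(* Only used for nonempty bs; the base case makes gamma[x:p,t] equal to
   (forall)({}(x:p,t)). *)
Fixpoint gamma (bs : ctx) (t : expr) : expr :=
  match bs with
  | [] => t
  | b :: bs => app_str [SOp (op_forall L)] [set_str [b] (gamma bs t)]
  end.

End Lang.

Arguments inE {U L} _ _.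
Arguments inS {U L} _ _.
Arguments Xi {U L} _ _.
Arguments isExpr {U L} _.
Arguments hypH {U L} _.
Arguments gamma {U L} _ _.
Arguments meaning {U L} _ _ _.
Arguments meaning0 {U L} _.

(* Main.v *)
(* The meaning of an expression t at a state s depends neither on the level nor
   on the rule that admits t, because it is D(s) for a function D of assignments
   that can be read off the string t alone: t has at most one parse.  If t is an
   expression with respect to k, then D only looks at the variables in dom(k),
   which is why rule (a) agrees with the other rules.  Once this is known, the
   theorem follows by peeling off the quantifiers of gamma one at a time; the
   collections of meanings involved are sets by replacement and union. *)

Require Import Defs.
From Stdlib Require Import List.
From Stdlib Require Import Classical ClassicalEpsilon.
From Stdlib Require Import FunctionalExtensionality PropExtensionality Lia.
Import ListNotations.

Set Implicit Arguments.
Unset Strict Implicit.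

(** * Descriptions, set formation and small classes *)

Section Sets.
Variable U : universe.

Lemma the_spec (P : U -> Prop) : (exists x, P x) -> P (the P).
Proof. exact (epsilon_spec _ P). Qed.

Lemma the_eq (P : U -> Prop) (x : U) : P x -> (forall y, P y -> y = x) -> the P = x.
Proof. intros Px Pu. apply Pu, the_spec. now exists x. Qed.

(** Equivalent predicates are equal by extensionality, so the same object is chosen even when
    nothing satisfies them. *)
Lemma the_ext (P Q : U -> Prop) : (forall x, P x <-> Q x) -> the P = the Q.
Proof.
  intros PQ. f_equal. apply functional_extensionality. intros x.
  now apply propositional_extensionality.
Qed.

Lemma setof_ext (P Q : U -> Prop) : (forall x, P x <-> Q x) -> setof P = setof Q.
Proof.
  intros PQ. apply the_ext. intros A.
  split; intros [sA memA]; split; trivial; intros x; rewrite memA;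
    [|symmetry]; apply PQ.
Qed.

(** [setof P] is an arbitrary object unless some set has exactly the elements described by [P];
    [small P] is this existence condition. *)
Definition small (P : U -> Prop) : Prop := exists A, is_set A /\ forall x, mem x A <-> P x.

Lemma setof_is_set (P : U -> Prop) : small P -> is_set (setof P).
Proof. intros sP. apply (the_spec sP). Qed.

Lemma mem_setof (P : U -> Prop) x : small P -> (mem x (setof P) <-> P x).
Proof. intros sP. apply (the_spec sP). Qed.

Lemma small_image (A : U) (F : U -> U) :
  is_set A -> small (fun z => exists v, mem v A /\ z = F v).
Proof.
  intros sA.
  destruct (set_replacement (R := fun x y => y = F x) sA) as [B [sB memB]].
  { intros; congruence. }
  exists B; split; trivial. intros z. rewrite memB.
  split; [intros [v Av ->] | intros [v [Av ->]]]; now exists v.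
Qed.

Lemma small_Union (I : U -> Prop) :
  small I -> small (fun z => exists y, I y /\ mem z y).
Proof.
  intros [A [sA memA]]. destruct (set_union sA) as [B [sB memB]].
  exists B; split; trivial. intros z. rewrite memB.
  split; [intros [y Ay zy] | intros [y [Iy zy]]]; exists y; firstorder.
Qed.

Lemma small_sing (a : U) : small (fun z => z = a).
Proof.
  destruct (set_pairing a a) as [A [sA memA]]. exists A; split; trivial.
  intros z. rewrite memA. tauto.
Qed.

Lemma small_iff (P Q : U -> Prop) : (forall x, P x <-> Q x) -> small P -> small Q.
Proof. intros PQ [A [sA memA]]. exists A; split; trivial. intros x. now rewrite memA. Qed.

Lemma truth_eq_vtrue (Q : Prop) : truth U Q = vtrue <-> Q.
Proof.
  unfold truth. destruct (excluded_middle_informative Q); split; try tauto.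
  intros e. now destruct (vtrue_neq_vfalse (eq_sym e)).
Qed.

End Sets.

(** * Denotations read off strings, and unique readability *)

Section Denotation.
Variable U : universe.
Variable L : language U.

Notation env := (var L -> U).
Notation SVar := (@SVar U L).
Notation SCst := (@SCst U L).
Notation SOp := (@SOp U L).
Notation LPar := (@LPar U L).
Notation RPar := (@RPar U L).
Notation Comma := (@Comma U L).
Notation Colon := (@Colon U L).
Notation Braces := (@Braces U L).

Definition update (e : env) (x : var L) (v : U) : env :=
  fun y => if excluded_middle_informative (y = x) then v else e y.

(* [body a C] reads a as x1:t1,...,xm:tm,t, and [C e] is the class of the
   values of t over the successive extensions of e. *)
Inductive denotes : expr L -> (env -> U) -> Prop :=
| denotes_var y : denotes [SVar y] (fun e => e y)
| denotes_cst c : denotes [SCst c] (fun _ => cst_meaning c)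
| denotes_app t G a As : denotes t G -> denotes_args a As ->
    denotes (LPar :: t ++ RPar :: LPar :: a ++ [RPar])
      (fun e => apply (G e) (map (fun A => A e) As))
| denotes_op f a As : denotes_args a As ->
    denotes (LPar :: SOp f :: RPar :: LPar :: a ++ [RPar])
      (fun e => op_val f (map (fun A => A e) As))
| denotes_set a C : denotes_body a C ->
    denotes (Braces :: LPar :: a ++ [RPar]) (fun e => setof (C e))
with denotes_args : expr L -> list (env -> U) -> Prop :=
| denotes_one t D : denotes t D -> denotes_args t [D]
| denotes_more t D a As : denotes t D -> denotes_args a As ->
    denotes_args (t ++ Comma :: a) (D :: As)
with denotes_body : expr L -> (env -> U -> Prop) -> Prop :=
| denotes_value t D : denotes t D -> denotes_body t (fun e z => z = D e)
| denotes_bind x t D a C : denotes t D -> denotes_body a C ->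
    denotes_body (SVar x :: Colon :: t ++ Comma :: a)
      (fun e z => exists v, mem v (D e) /\ C (update e x v) z).

Scheme denotes_mind := Minimality for denotes Sort Prop
with denotes_args_mind := Minimality for denotes_args Sort Prop
with denotes_body_mind := Minimality for denotes_body Sort Prop.
Combined Scheme denotes_mutind from denotes_mind, denotes_args_mind, denotes_body_mind.

Ltac flat := repeat (rewrite <- app_assoc in * || (progress cbn [app] in *)).

(* The continuations r, r' make the induction go through: a string with a
   denotation is never a proper initial segment of another one. *)
Lemma unique_readability :
  (forall t D, denotes t D -> forall t' D' r r', denotes t' D' ->
     t ++ r = t' ++ r' -> t = t' /\ r = r' /\ D = D')
  /\ (forall a As, denotes_args a As -> forall a' As' r r', denotes_args a' As' ->
     a ++ RPar :: r = a' ++ RPar :: r' -> a = a' /\ r = r' /\ As = As')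
  /\ (forall a C, denotes_body a C -> forall a' C' r r', denotes_body a' C' ->
     a ++ RPar :: r = a' ++ RPar :: r' -> a = a' /\ r = r' /\ C = C').
Proof.
  apply denotes_mutind.
  - intros y t' D' r r' d' E. inversion d'; subst; flat; inversion E; subst; auto.
  - intros c t' D' r r' d' E. inversion d'; subst; flat; inversion E; subst; auto.
  - intros t G a As dt IHt da IHa t' D' r r' d' E.
    inversion d' as [| |t1 G1 a1 As1 dt1 da1|f1 a1 As1 da1|]; subst; flat; inversion E as [E'].
    + destruct (IHt _ _ _ _ dt1 E') as [-> [E2 ->]]. inversion E2 as [E3].
      destruct (IHa _ _ _ _ da1 E3) as [-> [-> ->]]. auto.
    (* No denoting string begins with an operator symbol, so the application and operator rules
       never overlap. *)
    + inversion dt; subst; flat; discriminate.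
  - intros f a As da IHa t' D' r r' d' E.
    inversion d' as [| |t1 G1 a1 As1 dt1 da1|f1 a1 As1 da1|]; subst; flat; try discriminate.
    + injection E as E'. inversion dt1; subst; flat; discriminate.
    + injection E as -> E'. destruct (IHa _ _ _ _ da1 E') as [-> [-> ->]]. auto.
  - intros a C da IHa t' D' r r' d' E.
    inversion d' as [| | | |a1 C1 da1]; subst; flat; inversion E as [E'].
    destruct (IHa _ _ _ _ da1 E') as [-> [-> ->]]. auto.
  - intros t D dt IHt a' As' r r' d' E.
    inversion d' as [t1 D1 dt1|t1 D1 a1 As1 dt1 da1]; subst; flat;
      destruct (IHt _ _ _ _ dt1 E) as [-> [E2 ->]]; inversion E2; auto.
  - intros t D a As dt IHt da IHa a' As' r r' d' E.
    inversion d' as [t1 D1 dt1|t1 D1 a1 As1 dt1 da1]; subst; flat;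
      destruct (IHt _ _ _ _ dt1 E) as [-> [E2 ->]]; inversion E2 as [E3].
    destruct (IHa _ _ _ _ da1 E3) as [-> [-> ->]]. auto.
  - intros t D dt IHt a' C' r r' d' E.
    inversion d' as [t1 D1 dt1|x1 t1 D1 a1 C1 dt1 da1]; subst.
    + destruct (IHt _ _ _ _ dt1 E) as [-> [E2 ->]]; inversion E2; auto.
    (* A binder has [Colon] after its variable. A value that starts with the same variable is that
       variable alone, and [RPar] follows it. *)
    + inversion dt; subst; flat; discriminate.
  - intros x t D a C dt IHt da IHa a' C' r r' d' E.
    inversion d' as [t1 D1 dt1|x1 t1 D1 a1 C1 dt1 da1]; subst.
    + inversion dt1; subst; flat; discriminate.
    + flat. inversion E as [[Ex E1]].
      destruct (IHt _ _ _ _ dt1 E1) as [-> [E2 ->]]; inversion E2 as [E3].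
      destruct (IHa _ _ _ _ da1 E3) as [-> [-> ->]]. auto.
Qed.

Lemma denotes_inj t D D' : denotes t D -> denotes t D' -> D = D'.
Proof.
  intros d d'. destruct unique_readability as [H _].
  now destruct (H t D d t D' [] [] d' eq_refl) as [_ [_ ->]].
Qed.

(** * Dependence on assignments, and the invariant of the levels *)

Definition agree (X : list (var L)) (e e' : env) : Prop := forall y, In y X -> e y = e' y.

Definition depends_on (X : list (var L)) (D : env -> U) : Prop :=
  forall e e', agree X e e' -> D e = D e'.

Lemma agree_update X e e' x v :
  agree X e e' -> agree (X ++ [x]) (update e x v) (update e' x v).
Proof.
  intros A y Hy. unfold update. destruct (excluded_middle_informative (y = x)); trivial.
  apply in_app_or in Hy. destruct Hy as [Hy|[<-|[]]]; [now apply A|now destruct n].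
Qed.

Lemma dom_app (A B : Type) (s s' : soop A B) : dom (s ++ s') = dom s ++ dom s'.
Proof. apply map_app. Qed.

(** Freshness of [x] makes the appended pair the only one with first component [x], so the
    description in [lookup] is forced to pick [v]. *)
Lemma lookup_snoc (s : state L) x v :
  ~ In x (dom s) -> lookup (s ++ [(x, v)]) = update (lookup s) x v.
Proof.
  intros nx. apply functional_extensionality. intros y. unfold update.
  destruct (excluded_middle_informative (y = x)) as [->|ne].
  - apply the_eq; [apply in_or_app; simpl; auto|].
    intros u Hu. apply in_app_or in Hu. destruct Hu as [Hu|[Hu|[]]]; [|congruence].
    destruct nx. exact (in_map fst _ _ Hu).
  - apply the_ext. intros u. rewrite in_app_iff. simpl. intuition congruence.
Qed.

(** The invariant carried through the levels. By [coh_snoc] a nonempty context and its states can be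
    rebuilt from the data of the same stage, so the next stage adds no states over it. By
    [coh_denotes] a meaning is determined by the string, but only at states of the context. *)
Record coherent (S : stage L) : Prop := Coherent {
  coh_K_nil : stK S [];
  coh_E_K : forall k t, stE S k t -> stK S k;
  coh_Xi_K : forall k s, stXi S k s -> stK S k;
  coh_Xi_nil : forall s, stXi S [] s <-> s = [];
  coh_Xi_dom : forall k s, stXi S k s -> dom s = dom k;
  coh_snoc : forall h y p, stK S (h ++ [(y, p)]) ->
    Kplus S h y p
    /\ forall s, stXi S (h ++ [(y, p)]) s <->
         exists r v, stXi S h r /\ mem v (stmean S h p r) /\ s = r ++ [(y, v)];
  coh_denotes : forall k t, stE S k t -> exists D, denotes t D
    /\ depends_on (dom k) D
    /\ forall s, stXi S k s -> stmean S k t s = D (lookup s)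
}.

(** * One step of the simultaneous induction preserves the invariant *)

Section Level.
Variable S : stage L.
Hypothesis cS : coherent S.

Lemma coh_lookup h y p r v : Kplus S h y p -> stXi S h r ->
  lookup (r ++ [(y, v)]) = update (lookup r) y v.
Proof.
  intros [_ [_ [ny _]]] Hr. apply lookup_snoc. now rewrite (coh_Xi_dom cS Hr).
Qed.

Lemma coh_Xi_app bs : forall k s, stXi S (k ++ bs) s ->
  exists s1 s2, s = s1 ++ s2 /\ stXi S k s1.
Proof.
  induction bs as [|[y p] bs IH] using rev_ind; intros k s Hs.
  - exists s, []. now rewrite !app_nil_r in *.
  - rewrite app_assoc in Hs.
    apply (coh_snoc cS (coh_Xi_K cS Hs)) in Hs. destruct Hs as [r [v [Hr [_ ->]]]].
    destruct (IH _ _ Hr) as [s1 [s2 [-> H1]]].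
    exists s1, (s2 ++ [(y, v)]). now rewrite app_assoc.
Qed.

(** All states of [k] have the length of [k], so two of them that begin the same sequence
    coincide. *)
Lemma coh_Xi_prefix k r s q q' :
  stXi S k r -> stXi S k s -> r ++ q = s ++ q' -> r = s.
Proof.
  intros Hr Hs. assert (length r = length s) as E.
  { rewrite <- (length_map fst r), <- (length_map fst s). fold (dom r) (dom s).
    now rewrite (coh_Xi_dom cS Hr), (coh_Xi_dom cS Hs). }
  clear Hr Hs. revert s E.
  induction r as [|b r IH]; intros [|b' s] E E'; try discriminate; trivial.
  inversion E'; subst. f_equal. apply IH; auto.
Qed.

(** [P] keeps, for the denotations chosen here, the further facts that rules (c) and (d) use:
    dependence on [dom k] and agreement with the meanings. *)
Lemma denotes_comma_sep (P : expr L -> (env -> U) -> Prop) ts : ts <> [] ->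
  (forall p, In p ts -> exists D, denotes p D /\ P p D) ->
  exists As, denotes_args (comma_sep ts) As /\ Forall2 P ts As.
Proof.
  induction ts as [|t ts IH]; intros ne H; [congruence|].
  destruct (H t (or_introl eq_refl)) as [D [dt Pt]].
  destruct ts as [|t' ts].
  - exists [D]. split; [now constructor|auto].
  - destruct IH as [As [da Pa]]; [congruence|firstorder|].
    exists (D :: As). split; [|auto].
    change (comma_sep (t :: t' :: ts)) with (t ++ Comma :: comma_sep (t' :: ts)).
    now constructor.
Qed.

(** This is the content of rule (e). The induction moves the first binder into the context [k],
    which turns one quantification over states extending [s] into nested quantifications over the
    values of the binders. *)
Lemma denotes_binders bs : forall k t, 
  (forall l x p r, bs = l ++ (x, p) :: r ->
     stE S (k ++ l) p /\ stK S (k ++ l ++ [(x, p)])) ->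
  stE S (k ++ bs) t ->
  exists C, denotes_body
      (comma_sep (map (fun b => SVar (fst b) :: Colon :: snd b) bs ++ [t])) C
    /\ (forall e e', agree (dom k) e e' -> forall z, C e z <-> C e' z)
    /\ forall s, stXi S k s -> forall z,
         (exists s', stXi S (k ++ bs) s' /\ initial_segment s s'
            /\ z = stmean S (k ++ bs) t s') <-> C (lookup s) z.
Proof.
  induction bs as [|[x p] bs IH]; intros k t Hb Ht.
  - rewrite app_nil_r in *. destruct (coh_denotes cS Ht) as [D [dt [dep Hm]]].
    exists (fun e z => z = D e). split; [now constructor|]. split.
    + intros e e' A z. now rewrite (dep _ _ A).
    + intros s Hs z. split.
      * intros [s' [Hs' [[q ->] ->]]].
        (* Both [s] and its extension by [q] have domain [dom k]. *)
        assert (q = []) as ->.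
        { pose proof (coh_Xi_dom cS Hs') as E. rewrite <- (coh_Xi_dom cS Hs) in E.
          rewrite dom_app in E. rewrite <- (app_nil_r (dom s)) in E at 2.
          apply app_inv_head in E. now apply map_eq_nil in E. }
        rewrite app_nil_r in *. now apply Hm.
      * intros ->. exists s. split; trivial. split; [exists []; now rewrite app_nil_r|].
        now rewrite Hm.
  - destruct (Hb [] x p bs eq_refl) as [Hp HK]. rewrite app_nil_r in Hp. cbn [app] in HK.
    destruct (coh_denotes cS Hp) as [D [dp [dep Hm]]].
    destruct (coh_snoc cS HK) as [Kp HXi].
    destruct (IH (k ++ [(x, p)]) t) as [C [dC [depC HC]]].
    { intros l y q r ->. rewrite <- !app_assoc. exact (Hb ((x, p) :: l) y q r eq_refl). }
    { rewrite <- app_assoc. exact Ht. }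
    exists (fun e z => exists v, mem v (D e) /\ C (update e x v) z).
    rewrite <- app_assoc in HC. cbn [app] in HC.
    split; [|split].
    + replace (comma_sep _) with
        (SVar x :: Colon :: p ++ Comma :: comma_sep
           (map (fun b => SVar (fst b) :: Colon :: snd b) bs ++ [t])).
      * now constructor.
      (* [comma_sep] unfolds only once the list behind its first entry is visibly nonempty. *)
      * destruct bs; reflexivity.
    + intros e e' A z. rewrite (dep _ _ A).
      assert (forall v, C (update e x v) z <-> C (update e' x v) z) as HH.
      { intros v. apply depC. rewrite dom_app. now apply agree_update. }
      split; intros [v [Hv Hc]]; exists v; firstorder.
    + intros s Hs z. rewrite <- (Hm _ Hs). split.
      * intros [s' [Hs' [[q Eq] ->]]].
        (* Cut [s'] after the value of the first binder. The part before that value is a state of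
           [k] that begins [s'], as does [s], so the two are equal. *)
        destruct (@coh_Xi_app bs (k ++ [(x, p)]) s') as [s1 [s2 [E1 Hs1]]].
        { rewrite <- app_assoc. exact Hs'. }
        pose proof Hs1 as Hs1'. apply HXi in Hs1. destruct Hs1 as [r [v [Hr [Hv ->]]]].
        pose proof E1 as E2. rewrite Eq, <- app_assoc in E2.
        pose proof (coh_Xi_prefix Hs Hr E2) as <-.
        exists v. split; trivial.
        rewrite <- (coh_lookup _ Kp Hs). apply HC; trivial.
        exists s'. split; trivial. split; [now exists s2|reflexivity].
      * intros [v [Hv Hc]]. rewrite <- (coh_lookup _ Kp Hs) in Hc. apply HC in Hc.
        -- destruct Hc as [s' [Hs' [[q ->] ->]]]. eexists. split; [eassumption|].
           split; [|reflexivity]. exists ((x, v) :: q). now rewrite <- app_assoc.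
        -- apply HXi. exists s, v. auto.
Qed.

(** By [coh_snoc], the states which the next stage builds over an old context are already
    present. *)
Lemma next_Xi_old k s : stK S k -> (stXi (next S) k s <-> stXi S k s).
Proof.
  intros Hk. simpl. split; [|auto].
  intros [[_ H]|[h [y [p [r [v [Kp [-> [Hr [Hv ->]]]]]]]]]]; trivial.
  apply (coh_snoc cS Hk). exists r, v. auto.
Qed.

Lemma next_Xi_new h y p s : Kplus S h y p -> (stXi (next S) (h ++ [(y, p)]) s <->
  exists r v, stXi S h r /\ mem v (stmean S h p r) /\ s = r ++ [(y, v)]).
Proof.
  intros Kp. simpl. split.
  - intros [[Hk H]|[h' [y' [p' [r [v [Kp' [E [Hr [Hv ->]]]]]]]]]].
    + now apply (coh_snoc cS Hk).
    + apply app_inj_tail in E. destruct E as [<- E]. inversion E; subst. exists r, v. auto.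
  - intros [r [v [Hr [Hv ->]]]]. right. exists h, y, p, r, v. auto.
Qed.

(** Rules (0) and (a) leave the string and its denotation unchanged; every other rule builds the
    string by a matching constructor of [denotes]. *)
Lemma clause_denotes k t M B F : clause S k t M B F -> exists D, denotes t D
  /\ depends_on (dom k) D
  /\ forall s, stXi (next S) k s -> M s = D (lookup s).
Proof.
  intros cl. destruct cl as
    [k t Hk Ht|h y p t Kp Ht _|h y p Kp|k t ts Hk ne Ht Hts _|k f ts Hk ne Hts _
    |k bs t Hk ne nd fr Hb Ht].
  - destruct (coh_denotes cS Ht) as [D [dt [dep Hm]]]. exists D. split; trivial. split; trivial.
    intros s Hs. apply Hm. now apply next_Xi_old.
  - destruct (coh_denotes cS Ht) as [D [dt [dep Hm]]]. exists D. split; trivial. split.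
    + intros e e' A. apply dep. intros z Hz. apply A. rewrite dom_app, in_app_iff. auto.
    + intros s Hs. apply next_Xi_new in Hs; trivial. destruct Hs as [r [v [Hr [_ ->]]]].
      rewrite removelast_last, Hm; trivial. apply dep.
      (* The new variable [y] lies outside [dom h], the only part of the assignment that [D]
         inspects. *)
      intros z Hz. rewrite (coh_lookup _ Kp Hr). unfold update.
      destruct (excluded_middle_informative (z = y)) as [->|]; trivial.
      now destruct (proj1 (proj2 (proj2 Kp)) Hz).
  - exists (fun e => e y). split; [constructor|]. split; trivial.
    intros e e' A. apply A. rewrite dom_app, in_app_iff. simpl. auto.
  - destruct (coh_denotes cS Ht) as [G [dt [dep Hm]]].
    destruct (denotes_comma_sep (P := fun p D => depends_on (dom k) D
      /\ forall s, stXi S k s -> stmean S k p s = D (lookup s)) ne) as [As [da HF]].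
    { intros p Hp. apply (coh_denotes cS (Hts p Hp)). }
    eexists. split; [now apply denotes_app; [apply dt|apply da]|]. split.
    + intros e e' A. rewrite (dep _ _ A). f_equal.
      clear -HF A. induction HF as [|p D ts As [HD _] _ IH]; simpl; trivial.
      now rewrite (HD _ _ A), IH.
    + intros s Hs. apply next_Xi_old in Hs; trivial. rewrite Hm; trivial. f_equal.
      clear -HF Hs. induction HF as [|p D ts As [_ HD] _ IH]; simpl; trivial.
      now rewrite (HD _ Hs), IH.
  - destruct (denotes_comma_sep (P := fun p D => depends_on (dom k) D
      /\ forall s, stXi S k s -> stmean S k p s = D (lookup s)) ne) as [As [da HF]].
    { intros p Hp. apply (coh_denotes cS (Hts p Hp)). }
    eexists. split; [now apply denotes_op; apply da|]. split.
    + intros e e' A. f_equal.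
      clear -HF A. induction HF as [|p D ts As [HD _] _ IH]; simpl; trivial.
      now rewrite (HD _ _ A), IH.
    + intros s Hs. apply next_Xi_old in Hs; trivial. f_equal.
      clear -HF Hs. induction HF as [|p D ts As [_ HD] _ IH]; simpl; trivial.
      now rewrite (HD _ Hs), IH.
  - destruct (denotes_binders (bs := bs) (k := k) (t := t)) as [C [dC [dep HC]]]; trivial.
    { intros l x p r E. destruct (Hb l x p r E) as [? [_ ?]]. auto. }
    exists (fun e => setof (C e)). split; [now constructor|]. split.
    + intros e e' A. apply setof_ext. now apply dep.
    + intros s Hs. apply next_Xi_old in Hs; trivial. apply setof_ext. now apply HC.
Qed.

(** Two rules that admit [t] give denotations of the same string, hence equal values; so the
    description defining [stmean] in [next] has a unique solution at every state. *)
Lemma next_mean k t M B F s : clause S k t M B F -> stXi (next S) k s ->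
  stmean (next S) k t s = M s.
Proof.
  intros cl Hs. simpl. apply the_eq.
  - now exists M, B, F.
  - intros u [M' [B' [F' [cl' ->]]]].
    destruct (clause_denotes cl) as [D [d [_ HD]]].
    destruct (clause_denotes cl') as [D' [d' [_ HD']]].
    rewrite HD, HD'; trivial. now rewrite (denotes_inj d d').
Qed.

Lemma next_E_old k t : stE S k t -> stE (next S) k t.
Proof.
  intros Ht. simpl. do 3 eexists. apply clause_0; trivial. now apply (coh_E_K cS Ht).
Qed.

Lemma next_mean_old k t s : stE S k t -> stXi S k s ->
  stmean (next S) k t s = stmean S k t s.
Proof.
  intros Ht Hs. pose proof (coh_E_K cS Ht) as Hk.
  apply (next_mean (clause_0 Hk Ht)). now apply next_Xi_old.
Qed.

Lemma next_Kplus h y p : Kplus S h y p -> Kplus (next S) h y p.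
Proof.
  intros [Hh [Hp [ny Hs]]]. split; [now left|]. split; [now apply next_E_old|].
  split; trivial. intros r Hr. apply next_Xi_old in Hr; trivial.
  rewrite next_mean_old; auto.
Qed.

Lemma clause_K k t M B F : clause S k t M B F -> stK (next S) k.
Proof.
  intros []; try (now left); right; eauto.
Qed.

Lemma coherent_next : coherent (next S).
Proof.
  constructor.
  - left. apply cS.
  - intros k t [M [B [F cl]]]. exact (clause_K cl).
  - intros k s [[Hk _]|[h [y [p [r [v [Kp [-> _]]]]]]]]; [now left|right; eauto].
  - intros s. rewrite next_Xi_old; apply cS.
  - intros k s [[_ Hs]|[h [y [p [r [v [Kp [-> [Hr [_ ->]]]]]]]]]].
    + now apply (coh_Xi_dom cS).
    + rewrite !dom_app. now rewrite (coh_Xi_dom cS Hr).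
  - intros h y p Hk.
    (* An old context satisfies this by [coh_snoc], a new one by construction, since the last pair
       of a context is unique. *)
    assert (Kplus S h y p) as Kp.
    { destruct Hk as [Hk|[h' [y' [p' [Kp E]]]]]; [now apply (coh_snoc cS)|].
      apply app_inj_tail in E. destruct E as [-> E]. now inversion E. }
    split; [now apply next_Kplus|].
    intros s. rewrite next_Xi_new; trivial. destruct Kp as [Hh [Hp _]].
    split; intros [r [v [Hr [Hv ->]]]]; exists r, v.
    + rewrite next_Xi_old, next_mean_old; auto.
    + rewrite next_Xi_old in Hr; trivial. rewrite next_mean_old in Hv; auto.
  - intros k t [M [B [F cl]]]. destruct (clause_denotes cl) as [D [d [dep HD]]].
    exists D. split; trivial. split; trivial. intros s Hs.
    rewrite (next_mean cl Hs). now apply HD.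
Qed.

End Level.

(** * Independence of the level, and recursion for states and contexts without levels *)

Lemma coherent_stage1 : coherent (stage1 L).
Proof.
  constructor; simpl; trivial.
  - now intros k t [-> _].
  - now intros k s [-> _].
  - intuition.
  - now intros k s [-> ->].
  - intros h y p E. now destruct h.
  - intros k t [-> [c ->]]. exists (fun _ => cst_meaning c). split; [constructor|].
    split; [intros ? ? _; reflexivity|]. intros s _. apply the_eq.
    + now exists c.
    + intros u [c' [E ->]]. now inversion E.
Qed.

Lemma coherent_level n : coherent (level L n).
Proof. induction n; [exact coherent_stage1|now apply coherent_next]. Qed.

Lemma level_K n m k : n <= m -> stK (level L n) k -> stK (level L m) k.
Proof. induction 1; auto. intros; left; auto. Qed.

Lemma level_E n m k t : n <= m -> stE (level L n) k t -> stE (level L m) k t.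
Proof. induction 1; auto. intros; apply next_E_old; auto using coherent_level. Qed.

Lemma level_Xi n m k s : n <= m -> stK (level L n) k ->
  (stXi (level L m) k s <-> stXi (level L n) k s).
Proof.
  induction 1 as [|m le IH]; [tauto|]. intros Hk.
  rewrite <- IH; trivial. apply next_Xi_old; [apply coherent_level|].
  now apply (level_K le).
Qed.

Lemma Xi_level n k s : stK (level L n) k -> (Xi k s <-> stXi (level L n) k s).
Proof.
  intros Hk. split; [|intros H; now exists n].
  intros [m [Hm Hs]]. destruct (PeanoNat.Nat.le_ge_cases n m).
  - now apply (@level_Xi n m).
  - now apply (@level_Xi m n).
Qed.

(** Any two levels that contain [t] over [k] compute the denotation of the same string, so [meaning]
    may be evaluated at whichever level is convenient. *)
Lemma meaning_level n k t s : stE (level L n) k t -> Xi k s ->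
  meaning k t s = stmean (level L n) k t s.
Proof.
  intros Ht Hs. pose proof (coh_E_K (coherent_level n) Ht) as Hk.
  apply the_eq; [now exists n|].
  intros u [m [Hm [Ht' ->]]].
  destruct (coh_denotes (coherent_level n) Ht) as [D [d [_ HD]]].
  destruct (coh_denotes (coherent_level m) Ht') as [D' [d' [_ HD']]].
  rewrite HD, HD' by now apply Xi_level. now rewrite (denotes_inj d d').
Qed.

(** The bound covers all later levels so that several expressions can be brought to a common one. *)
Lemma inE_level k t : inE k t -> exists n, forall m, n <= m -> stE (level L m) k t.
Proof. intros [n [_ Ht]]. exists n. intros m le. now apply (level_E le). Qed.

Lemma inK_level k : inK k -> exists n, forall m, n <= m -> stK (level L m) k.
Proof. intros [n Hk]. exists n. intros m le. now apply (level_K le). Qed.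

Lemma inE_inK k t : inE k t -> inK (L := L) k.
Proof. intros [n [Hk _]]. now exists n. Qed.

Lemma Xi_nil s : Xi (L := L) [] s <-> s = [].
Proof. rewrite (@Xi_level 0) by reflexivity. apply coherent_level. Qed.

Lemma Xi_snoc h y p s : inK (L := L) (h ++ [(y, p)]) ->
  (Xi (h ++ [(y, p)]) s <->
   exists r v, Xi h r /\ mem v (meaning h p r) /\ s = r ++ [(y, v)]).
Proof.
  intros [n Hk]. rewrite Xi_level by eassumption.
  destruct (coh_snoc (coherent_level n) Hk) as [[Hh [Hp _]] ->].
  split; intros [r [v [Hr [Hv ->]]]]; exists r, v.
  - apply (Xi_level _ Hh) in Hr. now rewrite (meaning_level Hp Hr).
  - rewrite (meaning_level Hp Hr) in Hv. now apply (Xi_level _ Hh) in Hr.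
Qed.

Lemma inK_inv h y p : inK (L := L) (h ++ [(y, p)]) ->
  inK h /\ inE h p /\ ~ In y (dom h) /\ forall s, Xi h s -> is_set (meaning h p s).
Proof.
  intros [n Hk]. destruct (coh_snoc (coherent_level n) Hk) as [[Hh [Hp [ny Hs]]] _].
  split; [now exists n|]. split; [now exists n|]. split; trivial.
  intros s HX. rewrite (meaning_level Hp HX). apply Hs. now apply (Xi_level _ Hh).
Qed.

Lemma inK_prefix l r : inK (l ++ r) -> inK (L := L) l.
Proof.
  induction r as [|[y p] r IH] using rev_ind; [now rewrite app_nil_r|].
  rewrite app_assoc. intros Hk. apply IH, (inK_inv Hk).
Qed.

(** Induction on the context from its right end: for a fixed state [r] of [h] the last value ranges
    over a set, so replacement applies, and union then collects over all [r]. [F] is general because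
    the induction hypothesis is used with the set-valued map sending [r] to [setof (im r)]. *)
Lemma small_image_Xi k : inK (L := L) k -> forall F : state L -> U,
  small (fun z => exists s, Xi k s /\ z = F s).
Proof.
  induction k as [|[y p] h IH] using rev_ind; intros Hk F.
  - apply small_iff with (2 := small_sing (F [])). intros z. split.
    + intros ->. exists []. split; trivial. now apply Xi_nil.
    + intros [s [Hs ->]]. apply Xi_nil in Hs. now subst.
  - destruct (inK_inv Hk) as [Hh [_ [_ Hs]]].
    set (im r := fun z => exists v, mem v (meaning h p r) /\ z = F (r ++ [(y, v)])).
    assert (forall r, Xi h r -> small (im r)) as Him.
    { intros r Hr. apply (small_image (fun v => F (r ++ [(y, v)]))). now apply Hs. }
    apply small_iff with (2 := small_Union (IH Hh (fun r => setof (im r)))).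
    intros z. split.
    + intros [w [[r [Hr ->]] Hz]]. apply (mem_setof z (Him r Hr)) in Hz.
      destruct Hz as [v [Hv ->]]. exists (r ++ [(y, v)]). split; trivial.
      apply Xi_snoc; trivial. exists r, v. auto.
    + intros [s [HX ->]]. apply Xi_snoc in HX; trivial. destruct HX as [r [v [Hr [Hv ->]]]].
      exists (setof (im r)). split; [now exists r|]. apply (mem_setof _ (Him r Hr)). now exists v.
Qed.

(** * Peeling quantifiers off [gamma] *)

Lemma op_forall_true (P : U -> Prop) :
  small P -> (forall z, P z -> truth_valued z) ->
  op_app (op_forall L) [setof P]
  /\ truth_valued (op_val (op_forall L) [setof P])
  /\ (op_val (op_forall L) [setof P] = vtrue <-> forall z, P z -> z = vtrue).
Proof.
  intros sP tP.
  assert (op_app (op_forall L) [setof P]) as A.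
  { apply op_forall_app. exists (setof P). split; trivial.
    split; [now apply setof_is_set|]. intros y Hy. apply tP. now apply (mem_setof y sP). }
  split; trivial. rewrite (op_forall_val A). split.
  - unfold truth, truth_valued. destruct excluded_middle_informative; auto.
  - rewrite truth_eq_vtrue. split; intros H z Hz; apply H; now apply (mem_setof z sP).
Qed.

(** From a level [n] containing all the ingredients, rule (e) forms the set expression one level up
    and rule (d) the quantified formula two levels up. Membership in [inS l] is part of the
    conclusion so that the result can serve as the body of the next quantifier. *)
Lemma meaning_forall l x p t :
  inK (l ++ [(x, p)]) -> inS (l ++ [(x, p)]) t ->
  inS l (app_str [SOp (op_forall L)] [set_str [(x, p)] t])
  /\ forall s, Xi l s ->
     (meaning l (app_str [SOp (op_forall L)] [set_str [(x, p)] t]) s = vtrue <->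
      forall v, mem v (meaning l p s) -> meaning (l ++ [(x, p)]) t (s ++ [(x, v)]) = vtrue).
Proof.
  intros HK [Ht Htv]. destruct (inK_inv HK) as [Hl [Hp [nx Hs]]].
  destruct (inK_level HK) as [n1 H1]. destruct (inE_level Hp) as [n2 H2].
  destruct (inE_level Ht) as [n3 H3].
  (* The sum serves as a common upper bound of the three levels. *)
  set (n := n1 + n2 + n3).
  assert (stK (level L n) (l ++ [(x, p)])) as K1 by (apply H1; lia).
  assert (stE (level L n) l p) as E2 by (apply H2; lia).
  assert (stE (level L n) (l ++ [(x, p)]) t) as E3 by (apply H3; lia).
  pose proof (coh_E_K (coherent_level n) E2) as K2.
  assert (stK (level L (S n)) l) as K2' by now left.
  assert (stK (level L (S (S n))) l) as K2'' by now left.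
  unshelve epose proof (@clause_e _ _ (level L n) l [(x, p)] t K2 _ _ _ _ E3) as cl.
  { discriminate. }
  { repeat constructor. intros []. }
  { now intros y [<-|[]]. }
  (* A list with one binder decomposes only with an empty prefix. *)
  { intros l' x' p' r E. destruct l' as [|b l']; [|destruct l'; discriminate].
    inversion E; subst. rewrite app_nil_r. split; trivial. split; trivial.
    intros s Hr. rewrite <- (meaning_level E2) by now apply (Xi_level _ K2).
    apply Hs. now apply (Xi_level _ K2). }
  set (P s := fun z => exists v, mem v (meaning l p s)
                /\ z = meaning (l ++ [(x, p)]) t (s ++ [(x, v)])).
  assert (forall s, Xi l s ->
    stmean (level L (S n)) l (set_str [(x, p)] t) s = setof (P s)) as Hset.
  { intros s HX. rewrite (next_mean (coherent_level n) cl) by now apply (Xi_level _ K2').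
    apply setof_ext. intros z. split.
    - intros [s' [Hs' [[q E] ->]]]. apply (Xi_level _ K1) in Hs'.
      rewrite <- (meaning_level E3 Hs').
      pose proof (proj1 (Xi_snoc _ HK) Hs') as [r [v [Hr [Hv E']]]].
      rewrite E in E'.
      (* Both [s] and [r] are states of [l] that begin [s'], so they are equal and [s'] is [s]
         followed by one value for [x]. *)
      pose proof (coh_Xi_prefix (coherent_level n) (proj1 (Xi_level _ K2) HX)
        (proj1 (Xi_level _ K2) Hr) E') as <-.
      exists v. split; trivial. now rewrite E, E'.
    - intros [v [Hv ->]]. exists (s ++ [(x, v)]).
      assert (Xi (l ++ [(x, p)]) (s ++ [(x, v)])) as HX' by (apply Xi_snoc; eauto).
      rewrite <- (meaning_level E3 HX').
      split; [now apply (Xi_level _ K1)|]. split; [now eexists|reflexivity]. }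
  assert (forall s, Xi l s -> op_app (op_forall L) [setof (P s)]
     /\ truth_valued (op_val (op_forall L) [setof (P s)])
     /\ (op_val (op_forall L) [setof (P s)] = vtrue <-> forall z, P s z -> z = vtrue)) as HP.
  { intros s HX. apply op_forall_true.
    (* [P s] is the image of the set [meaning l p s], so replacement makes it small. *)
    - now apply (small_image (fun v => meaning (l ++ [(x, p)]) t (s ++ [(x, v)]))), Hs.
    - intros z [v [Hv ->]]. apply Htv, Xi_snoc; trivial. exists s, v. auto. }
  unshelve epose proof
    (@clause_d _ _ (level L (S n)) l (op_forall L) [set_str [(x, p)] t] K2' _ _ _) as cl2.
  { discriminate. }
  { intros q [<-|[]]. do 3 eexists. exact cl. }
  { intros s HX. apply (Xi_level _ K2') in HX. cbn [map]. rewrite Hset by trivial.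
    now apply HP. }
  assert (stE (level L (S (S n))) l (app_str [SOp (op_forall L)] [set_str [(x, p)] t])) as E4
    by (do 3 eexists; exact cl2).
  assert (forall s, Xi l s ->
    meaning l (app_str [SOp (op_forall L)] [set_str [(x, p)] t]) s
    = op_val (op_forall L) [setof (P s)]) as Hm.
  { intros s HX. rewrite (meaning_level E4 HX).
    rewrite (next_mean (coherent_level (S n)) cl2) by (now apply (Xi_level _ K2'')).
    cbn [map]. now rewrite Hset. }
  split; [split|].
  - now exists (S (S n)).
  - intros s HX. rewrite Hm by trivial. now apply HP.
  - intros s HX. rewrite Hm by trivial. rewrite (proj2 (proj2 (HP s HX))). split.
    + intros H v Hv. apply H. now exists v.
    + intros H z [v [Hv ->]]. auto.
Qed.

(** Induction on the binders [r] still to be quantified, for every split of [k] into [l] and [r]: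
    the outermost quantifier moves its binder into [l], and the state [s] grows by its value. *)
Lemma meaning_gamma (k : ctx L) (phi : expr L) : inK k -> inS k phi -> forall r l, k = l ++ r ->
  inS l (gamma r phi)
  /\ forall s, Xi l s ->
     (meaning l (gamma r phi) s = vtrue <->
      forall s', Xi k (s ++ s') -> meaning k phi (s ++ s') = vtrue).
Proof.
  intros Hk Hphi r. induction r as [|[x p] r IH]; intros l E.
  - rewrite app_nil_r in E. subst l. split; trivial. intros s HX. split.
    + intros Hv s' HX'. destruct Hk as [n Hk]. apply (Xi_level _ Hk) in HX, HX'.
      (* With no binders left, [s] and its extension are both states of [k], hence of equal
         length. *)
      assert (s = s ++ s') as <-; trivial.
      apply (coh_Xi_prefix (coherent_level n) HX HX' (q := s') (q' := [])).
      now rewrite app_nil_r.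
    + intros Hall. specialize (Hall []). rewrite app_nil_r in Hall. auto.
  - assert (k = (l ++ [(x, p)]) ++ r) as E0 by now rewrite <- app_assoc.
    assert (inK (l ++ [(x, p)])) as HK by (apply (@inK_prefix _ r); now rewrite <- E0).
    destruct (IH _ E0) as [HS Hm].
    destruct (meaning_forall HK HS) as [HS' Hm']. split; trivial.
    intros s HX. cbn [gamma]. rewrite (Hm' s HX). split.
    + intros Hall s' HX'.
      (* The value [v] of the outermost variable is found by cutting the state just after it; what
         precedes [v] must be [s], since both are states of [l]. *)
      assert (exists v s2, s' = (x, v) :: s2 /\ mem v (meaning l p s)) as [v [s2 [-> Hv]]].
      { destruct Hk as [n Hk]. pose proof (proj1 (Xi_level _ Hk) HX') as HL.
        rewrite E0 in HL.
        destruct (coh_Xi_app (coherent_level n) HL) as [s1 [s2 [E1 H1]]].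
        assert (Xi (l ++ [(x, p)]) s1) as H1'.
        { exists n. split; trivial. apply (coh_Xi_K (coherent_level n) H1). }
        apply (Xi_snoc _ HK) in H1'. destruct H1' as [r1 [v [Hr1 [Hv ->]]]].
        rewrite <- app_assoc in E1. destruct (inK_inv HK) as [[n' Hl] _].
        pose proof (coh_Xi_prefix (coherent_level n') (proj1 (Xi_level _ Hl) HX)
          (proj1 (Xi_level _ Hl) Hr1) E1) as <-.
        apply app_inv_head in E1. now exists v, s2. }
      change ((x, v) :: s2) with ([(x, v)] ++ s2) in *. rewrite app_assoc in *.
      apply Hm; auto. apply (Xi_snoc _ HK). now exists s, v.
    + intros Hall v Hv. apply Hm.
      * apply (Xi_snoc _ HK). now exists s, v.
      * intros s' HX'. rewrite <- app_assoc in *. now apply Hall.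
Qed.

End Denotation.

(** * The closed formula at the empty context, and the value of the universal quantifier *)

Theorem theorem3p5 (U : universe) (L : language U) (k : ctx L)
    (k_nonempty : 0 < length k)
    (x_distinct : NoDup (dom k))
    (phi_expr : forall x p, In (x, p) k -> isExpr p)
    (hH : hypH k)
    (phi : expr L) (hphi : inS k phi) :
  (meaning0 (gamma k phi) = vtrue <->
   op_val (op_forall L)
     [setof (fun z => exists s', Xi k s' /\ z = meaning k phi s')] = vtrue)
  /\ (meaning0 (gamma k phi) = vtrue <->
      forall s', Xi k s' -> meaning k phi s' = vtrue).
Proof.
  pose proof (inE_inK (proj1 hphi)) as Hk.
  (* With the empty prefix and the empty state, the extensions [s'] range over all states of [k]. *)
  destruct (@meaning_gamma U L k phi Hk hphi k [] eq_refl) as [_ Hm].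
  specialize (Hm [] (proj2 (Xi_nil []) eq_refl)). cbn [app] in Hm.
  split; [|exact Hm].
  unfold meaning0. rewrite Hm.
  (* The class of all meanings of [phi] is a set, so [setof] denotes it and the quantifier tests
     exactly its members. *)
  destruct (op_forall_true L (small_image_Xi Hk (meaning k phi))) as [_ [_ ->]].
  - intros z [s [HX ->]]. now apply hphi.
  - split; [intros H z [s [HX ->]]; auto|intros H s HX; apply H; now exists s].
Qed.
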